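(* Let $a,b,t_1,t_2$ be real numbers with $b>0$, $\frac12<a+b<1$, $0<t_1<1$ and $0<t_2<t_1$. Then $$t_1^{2a+2b-1}(1-t_2^2)^{a+b-1}\,F_1\!\left(2a+2b-1;\,b,\,b;\,a+2b;\ \frac{(1-t_1)(t_2+1)}{2(t_2-t_1)},\,\frac{(1-t_1)(t_2-1)}{2(t_2+t_1)}\right)$$ $$=(t_1^2-t_2^2)^{a+b-1}\,F_1\!\left(a+b;\,a+b-\tfrac12,\,1-a;\,a+2b;\ \frac{t_1^2-1}{t_1^2},\,\frac{t_1^2-1}{t_1^2-t_2^2}\right).$$
   Context: The Appell hypergeometric function is $$F_1(A;B,B';c;x,y)=\sum_{m,n\ge0}\frac{(A)_{m+n}(B)_m(B')_n}{(c)_{m+n}}\frac{x^my^n}{m!\,n!}$$ for $|x|,|y|<1$, where $(q)_m=\Gamma(q+m)/\Gamma(q)$. For $\mathrm{Re}(c)>\mathrm{Re}(A)>0$ it is analytically continued to $x,y\in\mathbb{C}\setminus[1,\infty)$ by $$F_1(A;B,B';c;x,y)=\frac{\Gamma(c)}{\Gamma(A)\Gamma(c-A)}\int_0^1u^{A-1}(1-u)^{c-A-1}(1-xu)^{-B}(1-yu)^{-B'}\,du,$$ with principal branches of the powers. The function values in the claim are understood in this sense. *)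

(* Defs.v *)
From mathcomp Require Import all_boot all_order all_algebra.
From mathcomp Require Import all_classical all_reals all_analysis.

Set Implicit Arguments.
Unset Strict Implicit.
Unset Printing Implicit Defensive.

Import Order.TTheory GRing.Theory Num.Theory.
Local Open Scope classical_set_scope.
Local Open Scope ring_scope.

(* Euler's integral, convergent for s > 0; not meaningful for s <= 0. *)
Definition Gamma (R : realType) (s : R) : R :=
  \int[@lebesgue_measure R]_(t in `]0, +oo[) (t `^ (s - 1) * expR (- t)).

(* F_1(A; B, B'; c; x, y) through its Euler integral, for real arguments with
   c > A > 0 and x, y < 1 (no meaning is intended outside this range). There
   1 - x u and 1 - y u are positive for u in (0, 1), so the principal branches
   of the powers are the real powers `^. *)
Definition appellF1 (R : realType) (A B B' c x y : R) : R :=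
  Gamma c / (Gamma A * Gamma (c - A)) *
  \int[@lebesgue_measure R]_(u in `]0, 1[)
    (u `^ (A - 1) * (1 - u) `^ (c - A - 1) *
     (1 - x * u) `^ (- B) * (1 - y * u) `^ (- B')).

(* Main.v *)
Require Import Defs.
From mathcomp Require Import all_boot all_order all_algebra.
From mathcomp Require Import all_classical all_reals all_analysis.
From mathcomp Require Import measurable_realfun ring lra.

Set Implicit Arguments.
Unset Strict Implicit.
Unset Printing Implicit Defensive.

Import Order.TTheory GRing.Theory Num.Theory.
Import numFieldNormedType.Exports.
Local Open Scope classical_set_scope.
Local Open Scope ring_scope.

(** Both sides are, up to explicit factors, the two iterated integrals of one
    positive function of two variables. Write s = a + b and
    h(v, w) = (v - t1)^(2s-2) (w - v^2)^(-s) (1 - w)^(b-1) (w - t2^2)^(a-1)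
    on the region t1 < v, v^2 < w < 1.

    Each inner integral involves three linear factors whose exponents add up to
    -2, so a Moebius change of variable turns it into a Beta integral
    ([euler_integral_moebius]). For fixed v the singular points are v^2, 1 and
    t2^2, and what is left is a multiple of (1-v^2)^(-a) (v^2-t2^2)^(-b). For
    fixed w the factor (w - v^2)^(-s) splits at v = sqrt w and v = - sqrt w, the
    singular points are t1, sqrt w and - sqrt w, and what is left is a multiple
    of (w-t1^2)^(s-1) w^(1/2-s). This second evaluation is where the quadratic
    nature of the transformation comes from. Tonelli's theorem equates the two
    results ([double_integral_exchange]).

    The substitutions u = 2(v-t1)/((1-t1)(1+v)) and u = (w-t1^2)/(1-t1^2) carry
    the remaining integrals to the Euler integrals of the two Appell functions
    ([appell_integral_first_marginal], [appell_integral_second_marginal]). The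
    two Beta constants have quotient
    Gamma(2s-1) Gamma(1-a) / (Gamma(s) Gamma(b)), which is exactly the quotient
    of the normalising factors, by the relation between Beta and Gamma
    ([beta_primeE]).

    All integrands are nonnegative, so the computation takes place in the
    extended reals; finiteness enters only through Gamma, by which one has to
    divide. *)

(** * Change of variable on open intervals for nonnegative integrands *)

(** The integrands met below blow up at the end points, so the change of variable
    on a segment, which wants continuity up to the boundary, is applied on an
    increasing sequence of segments exhausting the domain; monotone convergence
    does the rest. *)
Lemma ge0_integration_by_substitution_bigcup (R : realType) (F f G : R -> R)
    (a_ b_ : nat -> R) (D : set R) :
  D = \bigcup_n `[a_ n, b_ n]%classic -> open D ->
  {homo a_ : m n / (m <= n)%N >-> n <= m} ->
  {homo b_ : m n / (m <= n)%N >-> m <= n} ->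
  (forall n, a_ n < b_ n) ->
  (forall x, D x -> is_derive x 1 F (f x)) ->
  (forall x, D x -> {for x, continuous f}) ->
  (forall x, D x -> 0 < f x) ->
  (forall x, D x -> {for F x, continuous G}) ->
  (forall x, D x -> 0 <= G (F x)) ->
  (\int[lebesgue_measure]_(y in F @` D) (G y)%:E =
   \int[lebesgue_measure]_(x in D) (G (F x) * f x)%:E)%E.
Proof.
move=> DE oD a_dec b_inc ab dF cf f0 cG G0.
have segD n : `[a_ n, b_ n]%classic `<=` D by move=> x xab; rewrite DE; exists n.
have derF x : D x -> derivable F x 1 by move=> /dF[].
have F'E x : D x -> derive1 F x = f x by move=> /dF Fx; rewrite derive1E derive_val.
have cF x : D x -> {for x, continuous F}.
  by move=> /derF dFx; apply/differentiable_continuous/derivable1_diffP.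
have cwF n : {within `[a_ n, b_ n], continuous F}.
  by apply: continuous_in_subspaceT => x /[!inE] /segD; exact: cF.
have incF n : {in `[a_ n, b_ n] &, {homo F : x y / x < y}}.
  move=> x y /[!in_itv]/= /andP[ax _] /andP[_ yb] xy.
  have sub z : z \in `]a_ n, b_ n[ -> D z.
    by move=> /subset_itv_oo_cc zab; apply: (segD n).
  apply: (@gtr0_derive1_incr R F (a_ n) (b_ n)) => // z /sub Dz.
  - exact: derF.
  - by rewrite F'E// f0.
(* The intermediate value theorem identifies the image of each segment. *)
have imF n : F @` `[a_ n, b_ n]%classic = `[F (a_ n), F (b_ n)]%classic.
  have [an bn] : `[a_ n, b_ n]%classic (a_ n) /\ `[a_ n, b_ n]%classic (b_ n).
    by rewrite /= !in_itv/= !lexx (ltW (ab n)).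
  have Fab : F (a_ n) < F (b_ n) by exact: (incF n).
  rewrite eqEsubset; split=> [_ [x /= xab <-]|y /= yFab].
    move: xab; rewrite /= !in_itv/= => /andP[ax xb].
    have xab : x \in `[a_ n, b_ n] by rewrite in_itv/= ax.
    apply/andP; split.
      by move: ax; rewrite le_eqVlt => /predU1P[->//|?]; apply/ltW/(incF n).
    by move: xb; rewrite le_eqVlt => /predU1P[->//|?]; apply/ltW/(incF n).
  have [|x xab <-] := IVT (v := y) (ltW (ab n)) (cwF n).
    by move: yFab; rewrite in_itv/= (min_idPl (ltW Fab)) (max_idPr (ltW Fab)).
  by exists x.
have FDE : F @` D = \bigcup_n `[F (a_ n), F (b_ n)]%classic.
  by rewrite DE image_bigcup; apply: eq_bigcup => // n _; rewrite imF.
have segS : nondecreasing_seq (fun n => `[a_ n, b_ n]%classic).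
  move=> m n mn; rewrite subsetEset; apply: subset_itv.
    by rewrite bnd_simp a_dec.
  by rewrite bnd_simp b_inc.
have cGy n y : `[F (a_ n), F (b_ n)]%classic y -> {for y, continuous G}.
  by rewrite -imF => -[x /segD Dx <-]; exact: cG.
have eqn n : (\int[lebesgue_measure]_(y in `[F (a_ n), F (b_ n)]) (G y)%:E =
              \int[lebesgue_measure]_(x in `[a_ n, b_ n]) (G (F x) * f x)%:E)%E.
  have [an bn] : `[a_ n, b_ n]%classic (a_ n) /\ `[a_ n, b_ n]%classic (b_ n).
    by rewrite /= !in_itv/= !lexx (ltW (ab n)).
  have cF' x : D x -> derive1 F z @[z --> x] --> f x.
    move=> Dx; apply: cvg_trans (cf _ Dx); apply: near_eq_cvg.
    by near=> z; rewrite F'E//; near: z; exact: (open_nbhs_nbhs (conj oD Dx)).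
  rewrite (@integration_by_substitution_increasing R F).
  - apply: eq_integral => x /[!inE] /segD Dx /=.
    by rewrite fctE /= F'E.
  - exact: ltW.
  - exact: incF.
  - move=> x /subset_itv_oo_cc xab.
    have /segD Dx : `[a_ n, b_ n]%classic x by [].
    by rewrite /continuous_at F'E//; exact: cF'.
  - by apply/cvg_ex; exists (f (a_ n)); apply: cvg_at_right_filter; apply: cF'; exact: (segD n).
  - by apply/cvg_ex; exists (f (b_ n)); apply: cvg_at_left_filter; apply: cF'; exact: (segD n).
  - split.
    + move=> x /subset_itv_oo_cc xab.
      by apply: derF; apply: (segD n).
    + by apply: cvg_at_right_filter; apply: cF; exact: (segD n).
    + by apply: cvg_at_left_filter; apply: cF; exact: (segD n).
  - by apply: continuous_in_subspaceT => x /[!inE]; exact: cGy.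
have lhs := @ge0_nondecreasing_set_cvg_integral _ (measurableTypeR R) R
  (fun n => `[F (a_ n), F (b_ n)]%classic) (EFin \o G)
  lebesgue_measure.
have rhs := @ge0_nondecreasing_set_cvg_integral _ (measurableTypeR R) R
  (fun n => `[a_ n, b_ n]%classic) (fun x => (G (F x) * f x)%:E)
  lebesgue_measure.
rewrite FDE DE; apply: (cvg_unique _ _ (rhs _ _ _ _)) => //=.
- under eq_fun do rewrite -eqn; apply: lhs => //.
  + move=> m n mn; rewrite -!imF subsetEset; apply: image_subset.
    by move: (segS _ _ mn); rewrite subsetEset.
  + move=> n; apply/measurable_EFinP; apply: subspace_continuous_measurable_fun => //.
    by apply: continuous_in_subspaceT => x /[!inE]; exact: cGy.
  + by move=> n y; rewrite -imF => -[x /segD Dx <-]; rewrite lee_fin G0.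
- move=> n; apply/measurable_EFinP; apply: subspace_continuous_measurable_fun => //.
  apply: continuous_in_subspaceT => x /[!inE] /segD Dx.
  apply: (@continuousM _ _ (G \o F)); last exact: cf.
  by apply: continuous_comp; [exact: cF|exact: cG].
- by move=> n x /segD Dx; rewrite lee_fin mulr_ge0 ?G0// ltW// f0.
Unshelve. all: end_near. Qed.

Lemma itvoo_bigcup_itvcc (R : realType) (a b : R) : a < b ->
  `]a, b[%classic =
  \bigcup_n `[a + (b - a) / n.+3%:R, b - (b - a) / n.+3%:R]%classic.
Proof.
move=> ab; have ba0 : 0 < b - a by rewrite subr_gt0.
rewrite eqEsubset; split=> x /=; last first.
  move=> [n _]; rewrite /= !in_itv/= => /andP[ax xb].
  have d0 : 0 < (b - a) / n.+3%:R by rewrite divr_gt0.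
  by move: ((b - a) / _) d0 ax xb => d d0 ax xb; apply/andP; split; lra.
rewrite in_itv/= => /andP[ax xb].
have xa0 : 0 < x - a by rewrite subr_gt0.
have bx0 : 0 < b - x by rewrite subr_gt0.
pose k := (b - a) / (x - a) + (b - a) / (b - x).
have k0 : 0 <= k by rewrite addr_ge0// divr_ge0// ltW.
have kn : k < (Num.bound k).+3%:R.
  by rewrite (lt_le_trans (archi_boundP k0))// ler_nat -addn3 leq_addr.
exists (Num.bound k) => //=; rewrite in_itv/=.
have step y : 0 < y -> (b - a) / y <= k -> (b - a) / (Num.bound k).+3%:R <= y.
  move=> y0 yk; rewrite ler_pdivrMr// -ler_pdivrMl// mulrC.
  exact: le_trans yk (ltW kn).
have := step _ xa0; have := step _ bx0.
rewrite /k lerDl lerDr => /(_ (divr_ge0 (ltW ba0) (ltW xa0))) h1.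
move=> /(_ (divr_ge0 (ltW ba0) (ltW bx0))) h2.
by rewrite -lerBrDl h2/= lerBrDl -lerBrDr.
Qed.

Lemma itv0y_bigcup_itvcc (R : realType) :
  `]0 : R, +oo[%classic = \bigcup_n `[n.+2%:R^-1, n.+2%:R]%classic.
Proof.
rewrite eqEsubset; split=> x /=; last first.
  move=> [n _]; rewrite /= !in_itv/= andbT => /andP[+ _].
  by apply: lt_le_trans; rewrite invr_gt0.
rewrite in_itv/= andbT => x0.
pose k := x + x^-1.
have xV0 : 0 < x^-1 by rewrite invr_gt0.
have k0 : 0 <= k by rewrite addr_ge0// ltW.
have kn : k < (Num.bound k).+2%:R.
  by rewrite (lt_le_trans (archi_boundP k0))// ler_nat -addn2 leq_addr.
exists (Num.bound k) => //=; rewrite in_itv/=; apply/andP; split.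
  rewrite -[leRHS]invrK lef_pV2 ?posrE ?invr_gt0//.
  by rewrite (le_trans _ (ltW kn))// lerDr ltW.
by rewrite (le_trans _ (ltW kn))// lerDl ltW.
Qed.

(** The range of the substitution is described by an explicit inverse [Finv], which
    in practice is easier to provide than limits at the end points. *)
Lemma ge0_integration_by_substitution_itvoo (R : realType)
    (F f G Finv : R -> R) (a b : R) (E : set R) :
  a < b ->
  (forall x, a < x < b -> is_derive x 1 F (f x)) ->
  (forall x, a < x < b -> E (F x)) ->
  (forall y, E y -> a < Finv y < b /\ F (Finv y) = y) ->
  (forall x, a < x < b -> {for x, continuous f}) ->
  (forall x, a < x < b -> 0 < f x) ->
  (forall y, E y -> {for y, continuous G}) ->
  (forall y, E y -> 0 <= G y) ->
  (\int[lebesgue_measure]_(y in E) (G y)%:E =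
   \int[lebesgue_measure]_(x in `]a, b[) (G (F x) * f x)%:E)%E.
Proof.
move=> ab dF FE EF cf f0 cG G0.
have -> : E = F @` `]a, b[%classic.
  rewrite eqEsubset; split=> [y /EF[Finvy <-]|_ [x /= + <-]].
    by exists (Finv y).
  by rewrite in_itv/=; exact: FE.
have ba0 : 0 < b - a by rewrite subr_gt0.
have inv_dec m n : (m <= n)%N -> (b - a) / n.+3%:R <= (b - a) / m.+3%:R.
  by move=> mn; rewrite ler_pM2l// lef_pV2 ?posrE// ler_nat !ltnS.
apply: (ge0_integration_by_substitution_bigcup (itvoo_bigcup_itvcc ab)).
- exact: itv_open.
- by move=> m n mn; rewrite lerD2l inv_dec.
- by move=> m n mn; rewrite lerB// inv_dec.
- move=> n; have : (b - a) / n.+3%:R * 2 < b - a.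
    rewrite -mulrA gtr_pMr// mulrC ltr_pdivrMr// mul1r.
    by rewrite (ltr_nat R 2).
  by move: (_ / _) => d; lra.
- by move=> x; rewrite /= in_itv/=; exact: cf.
- by move=> x; rewrite /= in_itv/=; exact: f0.
- by move=> x; rewrite /= in_itv/= => /FE; exact: cG.
- by move=> x; rewrite /= in_itv/= => /FE; exact: G0.
Qed.

Lemma ge0_integration_by_substitution_itv0y (R : realType)
    (F f G Finv : R -> R) (E : set R) :
  (forall x : R, 0 < x -> is_derive x 1 F (f x)) ->
  (forall x : R, 0 < x -> E (F x)) ->
  (forall y, E y -> 0 < Finv y /\ F (Finv y) = y) ->
  (forall x : R, 0 < x -> {for x, continuous f}) ->
  (forall x : R, 0 < x -> 0 < f x) ->
  (forall y, E y -> {for y, continuous G}) ->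
  (forall y, E y -> 0 <= G y) ->
  (\int[lebesgue_measure]_(y in E) (G y)%:E =
   \int[lebesgue_measure]_(x in `]0%R, +oo[) (G (F x) * f x)%:E)%E.
Proof.
move=> dF FE EF cf f0 cG G0.
have -> : E = F @` `]0, +oo[%classic.
  rewrite eqEsubset; split=> [y /EF[Finvy <-]|_ [x /= + <-]].
    by exists (Finv y) => //; rewrite /= in_itv/= Finvy.
  by rewrite in_itv/= andbT; exact: FE.
apply: (ge0_integration_by_substitution_bigcup (itv0y_bigcup_itvcc R)).
- exact: rray_open.
- by move=> m n mn; rewrite lef_pV2 ?posrE// ler_nat !ltnS.
- by move=> m n mn; rewrite ler_nat !ltnS.
- move=> n; rewrite (@lt_trans _ _ 1)//; last by rewrite ltr1n.
  by rewrite invf_lt1// ltr1n.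
- by move=> x; rewrite /= in_itv/= andbT; exact: dF.
- by move=> x; rewrite /= in_itv/= andbT; exact: cf.
- by move=> x; rewrite /= in_itv/= andbT; exact: f0.
- by move=> x; rewrite /= in_itv/= andbT => /FE; exact: cG.
- by move=> x; rewrite /= in_itv/= andbT => /FE; exact: G0.
Qed.

(** * The Gamma integral: finiteness and positivity *)

Lemma powR_expR_ln (R : realType) (x r : R) : 0 < x -> x `^ r = expR (r * ln x).
Proof. by move=> x0; rewrite /powR gt_eqF. Qed.

Lemma cvg_powR (R : realType) (T : Type) (F : set_system T) {FF : Filter F}
    (h : T -> R) (r l : R) :
  h x @[x --> F] --> l -> 0 < l -> h x `^ r @[x --> F] --> l `^ r.
Proof.
move=> hl l0; have cl : {for l, continuous (@powR R ^~ r)}.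
  apply/differentiable_continuous/derivable1_diffP/derivable_powR.
  by rewrite in_itv/= l0.
exact: (continuous_cvg FF cl hl).
Qed.

Definition gamma_fun (R : realType) (s t : R) : R := t `^ (s - 1) * expR (- t).

Lemma gamma_fun_gt0 (R : realType) (s t : R) : 0 < t -> 0 < gamma_fun s t.
Proof. by move=> t0; rewrite mulr_gt0 ?powR_gt0 ?expR_gt0. Qed.

Lemma gamma_fun_ge0 (R : realType) (s t : R) : 0 <= gamma_fun s t.
Proof. by rewrite mulr_ge0 ?powR_ge0 ?expR_ge0. Qed.

Lemma measurable_gamma_fun (R : realType) (s : R) :
  measurable_fun setT (gamma_fun s).
Proof.
apply: measurable_funM; first exact: measurable_powR.
by apply: measurableT_comp => //; exact: measurable_expR.
Qed.

Lemma continuous_gamma_fun (R : realType) (s t : R) : 0 < t ->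
  {for t, continuous (gamma_fun s)}.
Proof.
move=> t0; apply: cvgM; first by apply: cvg_powR => //; exact: cvg_id.
have cN : - u @[u --> t] --> - t by apply: cvgN; exact: cvg_id.
exact: (cvg_comp _ _ cN (@continuous_expR R (- t))).
Qed.

(** The derivative of t^s / (1 + t^s), the distribution function of a log-logistic
    law. It has the same singularity t^(s-1) at the origin as the Gamma integrand
    and is integrable at infinity, so it dominates the latter on the whole
    half-line at once. *)
Definition loglogistic_pdf (R : realType) (s t : R) : R :=
  s * t `^ (s - 1) / (1 + t `^ s) ^+ 2.

Lemma loglogistic_pdf_gt0 (R : realType) (s t : R) : 0 < s -> 0 < t ->
  0 < loglogistic_pdf s t.
Proof.
move=> s0 t0; rewrite !mulr_gt0 ?invr_gt0 ?exprn_gt0 ?powR_gt0//.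
by rewrite addr_gt0 ?powR_gt0.
Qed.

Lemma continuous_loglogistic_pdf (R : realType) (s t : R) : 0 < t ->
  {for t, continuous (loglogistic_pdf s)}.
Proof.
move=> t0; have ct r : u `^ r @[u --> t] --> t `^ r.
  by apply: cvg_powR => //; exact: cvg_id.
apply: cvgM; first by apply: cvgM; [exact: cvg_cst|exact: ct].
apply: cvgV; first by rewrite expf_eq0/= gt_eqF ?addr_gt0 ?powR_gt0.
rewrite expr2; under eq_fun do rewrite expr2.
by apply: cvgM; (apply: cvgD; [exact: cvg_cst|exact: ct]).
Qed.

Lemma integral_loglogistic_pdf (R : realType) (s : R) : 0 < s ->
  (\int[lebesgue_measure]_(t in `]0%R, +oo[)
     (loglogistic_pdf s t)%:E = 1)%E.
Proof.
move=> s0.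
pose F (t : R) := t `^ s / (1 + t `^ s).
have p0 (t : R) : 0 < t -> 0 < 1 + t `^ s by move=> t0; rewrite addr_gt0 ?powR_gt0.
transitivity (\int[lebesgue_measure]_(y in `]0%R, 1%R[) (1 : R)%:E)%E; last first.
  rewrite integral_cst//= lebesgue_measure_itv/= lte_fin ltr01.
  by rewrite mul1e oppr0 adde0.
have dF (t : R) : 0 < t -> is_derive t 1 F (loglogistic_pdf s t).
  move=> t0; have dt := is_derive1_powR s t0.
  have d1t : is_derive t 1 (fun u => 1 + u `^ s) (0 + s * t `^ (s - 1)).
    exact: is_deriveD.
  have neq0 : 1 + t `^ s != 0 by rewrite gt_eqF ?p0.
  have dV := @is_deriveV _ (fun u => 1 + u `^ s) t _ _ neq0 d1t.
  have dM := is_deriveM dt dV.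
  apply: is_derive_eq; rewrite /loglogistic_pdf /GRing.scale/= add0r.
  by field.
rewrite (@ge0_integration_by_substitution_itv0y _ F _ (cst 1)
  (fun y => (y / (1 - y)) `^ s^-1) _ dF) //=.
- by apply: eq_integral => t _; rewrite mul1r.
- move=> t t0; rewrite in_itv/= /F divr_gt0 ?powR_gt0 ?p0//=.
  by rewrite ltr_pdivrMr ?p0// mul1r ltrDr.
- move=> y; rewrite in_itv/= => /andP[y0 y1].
  have yy0 : 0 < y / (1 - y) by rewrite divr_gt0// subr_gt0.
  split; first by rewrite powR_gt0.
  rewrite /F -powRrM mulVf ?gt_eqF// powRr1 ?ltW//.
  by field; rewrite subr_eq0 gt_eqF//= subrK oner_neq0.
- by move=> t; exact: continuous_loglogistic_pdf.
- by move=> t; exact: loglogistic_pdf_gt0.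
- by move=> y _; exact: cvg_cst.
Qed.

(** Since x^s <= e^(s x), taking x = t/(2s) gives t^s <= (2s)^s e^(t/2), hence
    (1 + t^s)^2 <= (1 + (2s)^s)^2 e^t. *)
Lemma gamma_fun_le (R : realType) (s t : R) : 0 < s -> 0 < t ->
  gamma_fun s t <= (1 + (2 * s) `^ s) ^+ 2 / s * loglogistic_pdf s t.
Proof.
move=> s0 t0; have ts0 : 0 < 1 + t `^ s by rewrite addr_gt0 ?powR_gt0.
have s20 : 0 < 2 * s by rewrite mulr_gt0.
have tsE : t `^ s <= (2 * s) `^ s * expR (t / 2).
  have {1}-> : t = 2 * s * (t / (2 * s)) by rewrite mulrC divfK// gt_eqF.
  rewrite powRM ?divr_ge0 ?(ltW t0) ?(ltW s20)// ler_wpM2l ?powR_ge0//.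
  rewrite (_ : t / 2 = s * (t / (2 * s))); last by field; rewrite gt_eqF.
  rewrite powR_expR_ln ?divr_gt0// ler_expR ler_pM2l//.
  by rewrite ltW// ln_sublinear// divr_gt0.
have e1 : 1 <= expR (t / 2) by rewrite -expR0 ler_expR divr_ge0// ltW.
have h : (1 + t `^ s) ^+ 2 <= (1 + (2 * s) `^ s) ^+ 2 * expR t.
  have -> : expR t = expR (t / 2) ^+ 2 by rewrite -expRM_natl; congr expR; field.
  rewrite -exprMn ler_sqr ?nnegrE ?(ltW ts0)//; last first.
    by rewrite mulr_ge0 ?expR_ge0// addr_ge0 ?powR_ge0.
  by rewrite mulrDl mul1r lerD.
rewrite /gamma_fun /loglogistic_pdf expRN mulrA mulrAC.
rewrite -(ler_pM2r (expR_gt0 t)) divfK ?gt_eqF ?expR_gt0//.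
rewrite -(ler_pM2r (exprn_gt0 2 ts0)).
rewrite [leRHS](_ : _ = t `^ (s - 1) * ((1 + (2 * s) `^ s) ^+ 2 * expR t)).
  by rewrite ler_pM2l ?powR_gt0.
by field; rewrite !gt_eqF.
Qed.

Lemma integral_gt0 (R : realType) (D : set R) (f : R -> R) :
  measurable D -> (0 < lebesgue_measure D)%E -> measurable_fun D f ->
  (forall x, D x -> 0 < f x) ->
  (0 < \int[lebesgue_measure]_(x in D) (f x)%:E)%E.
Proof.
move=> mD D0 mf f0.
rewrite lt0e integral_ge0 ?andbT; last by move=> x /f0; rewrite lee_fin => /ltW.
apply/negP => /eqP If0.
have [+ _] := ae_eq_integral_abs lebesgue_measure mD
  ((measurable_EFinP D f).2 mf).
have -> : (\int[lebesgue_measure]_(x in D) `|(EFin \o f) x| = 0)%E.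
  rewrite -If0; apply: eq_integral => x /[!inE] /f0 fx0 /=.
  by rewrite ger0_norm// ltW.
move=> /(_ erefl)[N [mN N0 DN]].
have : (lebesgue_measure D <= lebesgue_measure N)%E.
  apply: le_measure; rewrite ?inE// => x Dx; apply: DN => /= /(_ Dx)/eqP.
  by rewrite eqe gt_eqF ?f0.
by rewrite N0 leNgt D0.
Qed.

Lemma integral_Gamma (R : realType) (s : R) : 0 < s ->
  (\int[lebesgue_measure]_(t in `]0%R, +oo[) (gamma_fun s t)%:E = (Gamma s)%:E)%E.
Proof.
move=> s0; rewrite /Gamma /Rintegral fineK//.
rewrite ge0_fin_numE; last first.
  by apply: integral_ge0 => t _; rewrite lee_fin gamma_fun_ge0.
pose C := (1 + (2 * s) `^ s) ^+ 2 / s.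
have mpdf : measurable_fun (`]0%R, +oo[ : set R) (fun t => (loglogistic_pdf s t)%:E).
  apply/measurable_EFinP; apply: subspace_continuous_measurable_fun => //.
  apply: continuous_in_subspaceT => t; rewrite inE/= in_itv/= andbT.
  exact: continuous_loglogistic_pdf.
apply: (@le_lt_trans _ _ (C%:E * 1)%E); last by rewrite mule1 ltry.
rewrite -(integral_loglogistic_pdf s0) -ge0_integralZl//.
- apply: ge0_le_integral => //.
  + by move=> t _; rewrite lee_fin gamma_fun_ge0.
  + apply/measurable_EFinP; apply: measurable_funTS; exact: measurable_gamma_fun.
  + exact: measurable_funeM.
  + move=> t; rewrite /= in_itv/= andbT => t0.
    by rewrite lee_fin gamma_fun_le.
- move=> t; rewrite /= in_itv/= andbT => t0.
  by rewrite lee_fin ltW// loglogistic_pdf_gt0.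
- by rewrite lee_fin divr_ge0 ?exprn_ge0 ?addr_ge0 ?powR_ge0// ltW.
Qed.

Lemma Gamma_gt0 (R : realType) (s : R) : 0 < s -> 0 < Gamma s.
Proof.
move=> s0; rewrite -lte_fin -integral_Gamma//.
apply: integral_gt0 => //.
- by rewrite lebesgue_measure_itv/= ltry oppr0 addye// ltry.
- by apply: measurable_funTS; exact: measurable_gamma_fun.
- by move=> t; rewrite /= in_itv/= andbT => /gamma_fun_gt0.
Qed.

(** * Tonelli's theorem and the Beta integral *)

Lemma mem_itv0y (R : realType) (x : R) : `]0%R, +oo[%classic x -> 0 < x.
Proof. by rewrite /= in_itv/= andbT. Qed.

(** Tonelli's theorem for f extended by 0 outside the region [S]. Both families of
    sections of [S] are given explicitly, so that in each application the inner
    integrals are literally over intervals. *)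
Lemma tonelli_region (R : realType) (f : R * R -> R) (D1 D2 : set R)
    (E1 E2 : R -> set R) (S : set (measurableTypeR R * measurableTypeR R)) :
  measurable S -> measurable_fun (setT : set (measurableTypeR R * measurableTypeR R)) f ->
  (forall z, S z -> 0 <= f z) ->
  (forall x y, S (x, y) <-> D1 x /\ E1 x y) ->
  (forall x y, S (x, y) <-> D2 y /\ E2 y x) ->
  (\int[lebesgue_measure]_(x in D1)
     \int[lebesgue_measure]_(y in E1 x) (f (x, y))%:E =
   \int[lebesgue_measure]_(y in D2)
     \int[lebesgue_measure]_(x in E2 y) (f (x, y))%:E)%E.
Proof.
move=> mS mf f0 S1 S2.
pose g := ((EFin \o f) \_ S)%E.
have mg : measurable_fun setT g.
  apply/(measurable_restrictT _ mS)/measurable_EFinP.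
  exact: measurable_funTS.
have g0 z : (0 <= g z)%E.
  by apply: erestrict_ge0 => {}z Sz; rewrite lee_fin f0.
have gE x y : g (x, y) = if (x, y) \in S then (f (x, y))%:E else 0%E.
  by rewrite /g patchE.
have gE1 x : (\int[lebesgue_measure]_y g (x, y) =
    ((fun x => \int[lebesgue_measure]_(y in E1 x) (f (x, y))%:E) \_ D1) x)%E.
  rewrite patchE; case: ifPn => [/[!inE] D1x|/negP D1x].
    rewrite [RHS]integral_mkcond; apply: eq_integral => y _.
    rewrite gE patchE; congr (if _ then _ else _).
    by apply/idP/idP; rewrite !inE S1 => //; case.
  rewrite integral0_eq// => y _; rewrite gE ifF//; apply/negP => /[!inE].
  by rewrite S1 => -[Dx _]; apply: D1x; rewrite inE.
have gE2 y : (\int[lebesgue_measure]_x g (x, y) =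
    ((fun y => \int[lebesgue_measure]_(x in E2 y) (f (x, y))%:E) \_ D2) y)%E.
  rewrite patchE; case: ifPn => [/[!inE] D2y|/negP D2y].
    rewrite [RHS]integral_mkcond; apply: eq_integral => x _.
    rewrite gE patchE; congr (if _ then _ else _).
    by apply/idP/idP; rewrite !inE S2 => //; case.
  rewrite integral0_eq// => x _; rewrite gE ifF//; apply/negP => /[!inE].
  by rewrite S2 => -[Dy _]; apply: D2y; rewrite inE.
rewrite [LHS]integral_mkcond [RHS]integral_mkcond.
under eq_integral do rewrite -gE1.
under [RHS]eq_integral do rewrite -gE2.
exact: (@fubini_tonelli _ _ (measurableTypeR R) (measurableTypeR R) R
  lebesgue_measure lebesgue_measure g mg g0).
Qed.

Lemma integral_gamma_fun_scale (R : realType) (s k : R) : 0 < s -> 0 < k ->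
  (\int[lebesgue_measure]_(t in `]0%R, +oo[) (gamma_fun s (k * t) * k)%:E =
   (Gamma s)%:E)%E.
Proof.
move=> s0 k0; have dF (t : R) : 0 < t -> is_derive t 1 ( *%R k) k.
  move=> _; have dM := is_deriveM (is_derive_cst k t 1) (is_derive_id t 1).
  by apply: (@is_derive_eq _ _ _ _ _ _ _ _ dM); rewrite scaler0 addr0 /GRing.scale/= mulr1.
rewrite -integral_Gamma//.
rewrite (@ge0_integration_by_substitution_itv0y _ ( *%R k) (cst k) (gamma_fun s)
  (fun y => y / k) _ dF)//.
- by move=> t t0; rewrite /= in_itv/= andbT mulr_gt0.
- move=> y; rewrite /= in_itv/= andbT => y0.
  by rewrite divr_gt0// mulrC divfK// gt_eqF.
- by move=> t _; exact: cvg_cst.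
- by move=> y; rewrite /= in_itv/= andbT; exact: continuous_gamma_fun.
- by move=> y _; exact: gamma_fun_ge0.
Qed.

(** The Beta function of p and q, in its form on the half-line (v = u / (1 - u)). *)
Definition beta_prime (R : realType) (p q : R) : \bar R :=
  (\int[lebesgue_measure]_(v in `]0%R, +oo[)
     (v `^ (p - 1) * (1 + v) `^ (- (p + q)))%:E)%E.

(** In Gamma(q) Gamma(p) as a double integral in x and y, the substitution y = x v
    followed by integration in x first leaves Gamma(p + q) (1 + v)^(-(p+q)). *)
Lemma beta_primeE (R : realType) (p q : R) : 0 < p -> 0 < q ->
  beta_prime p q = (Gamma p * Gamma q / Gamma (p + q))%:E.
Proof.
move=> p0 q0; have pq0 : 0 < p + q by rewrite addr_gt0.
pose mu := @lebesgue_measure R.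
pose h (z : R * R) := gamma_fun q z.1 * (gamma_fun p (z.1 * z.2) * z.1).
have h0 z : 0 < z.1 -> 0 < z.2 -> 0 <= h z.
  by move=> z1 z2; rewrite /h !mulr_ge0 ?powR_ge0 ?expR_ge0 ?(ltW z1).
have mh : measurable_fun (setT : set (measurableTypeR R * measurableTypeR R)) h.
  apply: measurable_funM.
    exact: measurableT_comp (measurable_gamma_fun q) measurable_fst.
  apply: measurable_funM; last exact: measurable_fst.
  apply: measurableT_comp (measurable_gamma_fun p) _.
  by apply: measurable_funM; [exact: measurable_fst|exact: measurable_snd].
have mg s c : measurable_fun (`]0%R, +oo[ : set R)
    (fun t => (gamma_fun s (c * t) * c)%:E).
  apply/measurable_EFinP/measurable_funTS.
  apply: measurable_funM => //.
  apply: measurableT_comp (measurable_gamma_fun s) _.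
  exact: measurable_funM.
have hE x v : 0 < x -> 0 < v -> h (x, v) =
    v `^ (p - 1) * (1 + v) `^ (- (p + q)) * (gamma_fun (p + q) ((1 + v) * x) * (1 + v)).
  move=> x0 v0; have v10 : 0 < 1 + v by rewrite addr_gt0.
  rewrite /h /gamma_fun /= !powRM ?(ltW x0) ?(ltW v0) ?(ltW v10)//.
  rewrite -[X in _ * (_ * X) = _](powRr1 (ltW x0)).
  rewrite -[X in _ = _ * (_ * X)](powRr1 (ltW v10)).
  by rewrite !powR_expR_ln// -!expRD; congr expR; ring.
(* Inner integral in v: rescaling by x. *)
have lhs : (\int[mu]_(x in `]0%R, +oo[) \int[mu]_(v in `]0%R, +oo[) (h (x, v))%:E =
    (Gamma p * Gamma q)%:E)%E.
  rewrite EFinM -(integral_Gamma q0) -ge0_integralZl//; first last.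
  - by rewrite lee_fin ltW// Gamma_gt0.
  - by move=> x _; rewrite lee_fin gamma_fun_ge0.
  - by apply/measurable_EFinP/measurable_funTS; exact: measurable_gamma_fun.
  apply: eq_integral => x /set_mem/(@mem_itv0y R) x0.
  rewrite muleC -(integral_gamma_fun_scale p0 x0) -ge0_integralZl//.
  - exact: mg.
  - by move=> t _; rewrite lee_fin !mulr_ge0 ?powR_ge0 ?expR_ge0// ltW.
  - by rewrite lee_fin gamma_fun_ge0.
(* Inner integral in x: rescaling by 1 + v. *)
have rhs : (\int[mu]_(v in `]0%R, +oo[) \int[mu]_(x in `]0%R, +oo[) (h (x, v))%:E =
    (Gamma (p + q))%:E * beta_prime p q)%E.
  rewrite /beta_prime -ge0_integralZl//; first last.
  - by rewrite lee_fin ltW// Gamma_gt0.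
  - by move=> v _; rewrite lee_fin mulr_ge0 ?powR_ge0.
  - apply/measurable_EFinP/measurable_funTS.
    apply: measurable_funM; first exact: measurable_powR.
    apply: measurableT_comp (measurable_powR _) _.
    exact: measurable_funD.
  apply: eq_integral => v /set_mem/(@mem_itv0y R) v0.
  have v10 : 0 < 1 + v by rewrite addr_gt0.
  rewrite muleC -(integral_gamma_fun_scale pq0 v10) -ge0_integralZl//.
  - by apply: eq_integral => x /set_mem/(@mem_itv0y R) x0; rewrite hE.
  - exact: mg.
  - by move=> t _; rewrite lee_fin !mulr_ge0 ?powR_ge0 ?expR_ge0// ltW.
  - by rewrite lee_fin mulr_ge0 ?powR_ge0.
have : ((Gamma (p + q))%:E * beta_prime p q = (Gamma p * Gamma q)%:E)%E.
  rewrite -lhs -rhs; apply/esym.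
  apply: (@tonelli_region _ h _ _ (fun=> `]0%R, +oo[%classic)
    (fun=> `]0%R, +oo[%classic) (`]0%R, +oo[%classic `*` `]0%R, +oo[%classic)) => //.
  - by apply: measurableX.
  - by move=> [x v] [/(@mem_itv0y R) x0 /(@mem_itv0y R) v0]; exact: h0.
  - by move=> x y; split=> -[].
move=> /(congr1 (fun t => (Gamma (p + q))^-1%:E * t)%E).
have G0 : Gamma (p + q) != 0 by rewrite gt_eqF ?Gamma_gt0.
by rewrite muleA -EFinM mulVf// mul1e => ->; rewrite -EFinM mulrC.
Qed.

(** * Moebius substitutions and the three-point Euler integral *)

Lemma is_derive_moebius (R : realType) (a b c d x : R) : 0 < c * x + d ->
  is_derive x 1 (fun y => (a * y + b) / (c * y + d))
    ((a * d - b * c) / (c * x + d) ^+ 2).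
Proof.
move=> cxd0; have cxd_neq0 : c * x + d != 0 by rewrite gt_eqF.
have affine (u v : R) : is_derive x 1 (fun y => u * y + v) u.
  have dM := is_deriveM (is_derive_cst u x 1) (is_derive_id x 1).
  have dD := is_deriveD dM (is_derive_cst v x 1).
  apply: (@is_derive_eq _ _ _ _ _ _ _ _ dD).
  by rewrite scaler0 !addr0 /GRing.scale/= mulr1.
have dV := @is_deriveV _ (fun y => c * y + d) x _ _ cxd_neq0 (affine c d).
have dM := is_deriveM (affine a b) dV.
apply: (@is_derive_eq _ _ _ _ _ _ _ _ dM).
by rewrite /GRing.scale/=; field.
Qed.

Lemma ge0_integration_by_moebius (R : realType) (a b c d A B : R)
    (Finv G : R -> R) (E : set R) :
  A < B -> 0 < a * d - b * c ->
  (forall x, A < x < B -> 0 < c * x + d) ->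
  (forall x, A < x < B -> E ((a * x + b) / (c * x + d))) ->
  (forall y, E y ->
     A < Finv y < B /\ (a * Finv y + b) / (c * Finv y + d) = y) ->
  (forall y, E y -> {for y, continuous G}) ->
  (forall y, E y -> 0 <= G y) ->
  (\int[lebesgue_measure]_(y in E) (G y)%:E =
   \int[lebesgue_measure]_(x in `]A, B[)
     (G ((a * x + b) / (c * x + d)) *
      ((a * d - b * c) / (c * x + d) ^+ 2))%:E)%E.
Proof.
move=> AB det0 den0 FE EF cG G0.
have dF x : A < x < B -> is_derive x 1 (fun y => (a * y + b) / (c * y + d))
    ((a * d - b * c) / (c * x + d) ^+ 2).
  by move=> /den0; exact: is_derive_moebius.
apply: (ge0_integration_by_substitution_itvoo AB dF FE EF) => // x /den0 x0.
  apply: cvgM; first exact: cvg_cst.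
  apply: cvgV; first by rewrite expf_eq0/= gt_eqF.
  have cD : c * y + d @[y --> x] --> c * x + d.
    apply: cvgD; last exact: cvg_cst.
    by apply: cvgM; [exact: cvg_cst|exact: cvg_id].
  by rewrite expr2; under eq_fun do rewrite expr2; exact: cvgM.
by rewrite divr_gt0 ?exprn_gt0.
Qed.

(** The exponents p - 1, q - 1 and -(p + q) add up to -2, so the point at infinity
    is regular, and the Moebius map sending A, B and -D to 0, infinity and -1
    makes the integral a Beta integral. *)
Lemma euler_integral_moebius (R : realType) (A B D p q : R) : A < B -> 0 < A + D ->
  (\int[lebesgue_measure]_(x in `]A, B[)
     ((x - A) `^ (p - 1) * (B - x) `^ (q - 1) * (x + D) `^ (- (p + q)))%:E =
   ((B - A) `^ (p + q - 1) * (A + D) `^ (- q) * (B + D) `^ (- p))%:E *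
   beta_prime p q)%E.
Proof.
move=> AB AD0; have BA0 : 0 < B - A by rewrite subr_gt0.
have BD0 : 0 < B + D by rewrite (lt_trans AD0)// ltrD2r.
(* The slope for which 1 + k (x - A) / (B - x) vanishes at x = - D. *)
have [k kE k0] : exists2 k, k = (B + D) / (A + D) & 0 < k.
  by exists ((B + D) / (A + D)) => //; rewrite divr_gt0.
pose C := (B - A) `^ (p + q - 1) * (A + D) `^ (- q) * (B + D) `^ (- p).
have C0 : 0 < C by rewrite !mulr_gt0 ?powR_gt0.
pose g (x : R) := (x - A) `^ (p - 1) * (B - x) `^ (q - 1) * (x + D) `^ (- (p + q)).
have g0 x : 0 <= g x by rewrite !mulr_ge0 ?powR_ge0.
suff -> : beta_prime p q =
    (C^-1%:E * \int[lebesgue_measure]_(x in `]A, B[) (g x)%:E)%E.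
  by rewrite muleA -EFinM divff ?gt_eqF// mul1e.
rewrite -ge0_integralZl//; last 3 first.
- apply/measurable_EFinP/measurable_funTS.
  apply: measurable_funM; last first.
    by apply: measurableT_comp (measurable_powR _) _; exact: measurable_funD.
  apply: measurable_funM.
    by apply: measurableT_comp (measurable_powR _) _; exact: measurable_funB.
  by apply: measurableT_comp (measurable_powR _) _; exact: measurable_funB.
- by move=> x _; rewrite lee_fin g0.
- by rewrite lee_fin invr_ge0 ltW.
rewrite /beta_prime (@ge0_integration_by_moebius _ k (- (k * A)) (- 1) B A B
  (fun y => (k * A + y * B) / (k + y)) _ _ AB)//.
- apply: eq_integral => x; rewrite inE/= in_itv/= => /andP[Ax xB].
  have xA0 : 0 < x - A by rewrite subr_gt0.
  have Bx0 : 0 < B - x by rewrite subr_gt0.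
  have xD0 : 0 < x + D by rewrite (lt_trans AD0)// ltrD2r.
  have den : -1 * x + B = B - x by ring.
  have num : k * x - k * A = k * (x - A) by ring.
  have onep : 1 + k * (x - A) / (B - x) =
      (B - A) * (x + D) / ((A + D) * (B - x)).
    by rewrite kE; field; rewrite !gt_eqF.
  have det : (k * B - - (k * A) * -1) = k * (B - A) by ring.
  rewrite den num onep det /g /C; congr (_%:E).
  have j0 : 0 < k * (B - A) / (B - x) ^+ 2 by rewrite divr_gt0 ?mulr_gt0 ?exprn_gt0.
  (* All factors are powers of positive linear forms: compare logarithms. *)
  rewrite -[X in _ * X = _](lnK j0).
  rewrite !powR_expR_ln ?divr_gt0 ?mulr_gt0 ?expR_gt0//.
  rewrite -!expRD -expRN -expRD kE; congr expR.
  rewrite !(ln_div, lnM, lnXn) ?posrE ?mulr_gt0 ?invr_gt0 ?exprn_gt0//.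
  by rewrite mulr2n; ring.
- have -> : k * B - - (k * A) * -1 = k * (B - A) by ring.
  by rewrite mulr_gt0.
- by move=> x /andP[Ax xB]; lra.
- move=> x /andP[Ax xB]; rewrite /= in_itv/= andbT.
  have -> : k * x - k * A = k * (x - A) by ring.
  by rewrite divr_gt0 ?mulr_gt0 ?subr_gt0//; lra.
- move=> y; rewrite /= in_itv/= andbT => y0; have ky0 : 0 < k + y by rewrite addr_gt0.
  split.
    rewrite ltr_pdivlMr// ltr_pdivrMr// -subr_gt0 -[X in _ && X]subr_gt0.
    have -> : k * A + y * B - A * (k + y) = y * (B - A) by ring.
    have -> : B * (k + y) - (k * A + y * B) = k * (B - A) by ring.
    by rewrite !mulr_gt0.
  field; rewrite gt_eqF//=.
  have -> : (-1) * (k * A + y * B) + B * (k + y) = k * (B - A) by ring.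
  by rewrite gt_eqF ?mulr_gt0.
- move=> y; rewrite /= in_itv/= andbT => y0.
  apply: cvgM; first by apply: cvg_powR => //; apply: cvg_id.
  apply: cvg_powR; last by rewrite addr_gt0.
  by apply: cvgD; [exact: cvg_cst|exact: cvg_id].
- by move=> y _; rewrite mulr_ge0 ?powR_ge0.
Qed.

(** * The two Appell integrals as marginals of one double integral *)

(** Up to a constant, what is left of the double integral of h (see the top of the
    file) after integration in w. *)
Definition first_marginal (R : realType) (a b t1 t2 : R) : \bar R :=
  (\int[lebesgue_measure]_(v in `]t1, 1%R[)
     ((v - t1) `^ (2 * (a + b) - 1 - 1) *
      ((1 - v ^+ 2) `^ (- a) * (v ^+ 2 - t2 ^+ 2) `^ (- b)))%:E)%E.

(** The same after integration in v. *)
Definition second_marginal (R : realType) (a b t1 t2 : R) : \bar R :=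
  (\int[lebesgue_measure]_(w in `](t1 ^+ 2)%R, 1%R[)
     ((1 - w) `^ (b - 1) * (w - t2 ^+ 2) `^ (a - 1) *
      ((w - t1 ^+ 2) `^ (a + b - 1) * w `^ (1 / 2 - (a + b))))%:E)%E.

(** Under u = 2(v-t1)/((1-t1)(1+v)) the points v = t1, 1, -1, t2, -t2 go to
    u = 0, 1, infinity, 1/x, 1/y. The exponents at 1 and at infinity are both -a,
    and those at 1/x and 1/y are both -b, hence the even function of v times
    (v - t1)^(2a+2b-2). *)
Lemma appell_integral_first_marginal (R : realType) (a b t1 t2 : R) :
  0 < t2 -> t2 < t1 -> t1 < 1 ->
  let x := (1 - t1) * (t2 + 1) / (2 * (t2 - t1)) in
  let y := (1 - t1) * (t2 - 1) / (2 * (t2 + t1)) in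
  (\int[lebesgue_measure]_(u in `]0%R, 1%R[)
     (u `^ (2 * a + 2 * b - 1 - 1) *
      (1 - u) `^ (a + 2 * b - (2 * a + 2 * b - 1) - 1) *
      (1 - x * u) `^ (- b) * (1 - y * u) `^ (- b))%:E =
   (2 `^ (2 * a + 2 * b - 1) * (1 - t1 ^+ 2) `^ (1 - a - 2 * b) *
    (t1 ^+ 2 - t2 ^+ 2) `^ b)%:E *
   first_marginal a b t1 t2)%E.
Proof.
move=> t20 t21 t11 x y; rewrite /first_marginal.
have t10 : 0 < t1 by exact: lt_trans t21.
have pos : [/\ 0 < 1 - t1, 0 < 1 + t1, 0 < t1 - t2 & 0 < t1 + t2] by split; lra.
have [p1 p2 p3 p4] := pos.
have xE : x = - ((1 - t1) * (1 + t2) / (2 * (t1 - t2))).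
  by rewrite /x -(opprB t1 t2); field; rewrite gt_eqF.
have yE : y = - ((1 - t1) * (1 - t2) / (2 * (t1 + t2))).
  by rewrite /y (addrC t2); field; rewrite !gt_eqF.
have x0 : x < 0 by rewrite xE oppr_lt0 divr_gt0 ?mulr_gt0//; lra.
have y0 : y < 0 by rewrite yE oppr_lt0 divr_gt0 ?mulr_gt0//; lra.
rewrite -ge0_integralZl//; last 3 first.
- apply/measurable_EFinP/measurable_funTS.
  apply: measurable_funM.
    by apply: measurableT_comp (measurable_powR _) _; exact: measurable_funB.
  apply: measurable_funM; apply: measurableT_comp (measurable_powR _) _.
    by apply: measurable_funB => //; exact: measurable_funX.
  by apply: measurable_funB => //; exact: measurable_funX.
- by move=> v _; rewrite lee_fin !mulr_ge0 ?powR_ge0.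
- by rewrite lee_fin !mulr_ge0 ?powR_ge0.
rewrite (@ge0_integration_by_moebius _ 2 (- (2 * t1)) (1 - t1) (1 - t1) t1 1
  (fun u => (2 * t1 + (1 - t1) * u) / (2 - (1 - t1) * u)) _ _ t11)//.
- apply: eq_integral => v; rewrite inE/= in_itv/= => /andP[tv v1].
  have [q1 q2 q3 q4 q5] : [/\ 0 < v - t1, 0 < 1 - v, 0 < 1 + v, 0 < v - t2 & 0 < v + t2].
    by split; lra.
  have den : (1 - t1) * v + (1 - t1) = (1 - t1) * (1 + v) by ring.
  have den0 : (1 - t1) * (1 + v) != 0 by rewrite mulf_neq0 ?gt_eqF.
  have E1 : (2 * v - 2 * t1) / ((1 - t1) * v + (1 - t1)) =
      2 * (v - t1) / ((1 - t1) * (1 + v)) by rewrite den; congr (_ / _); ring.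
  have E2 : 1 - 2 * (v - t1) / ((1 - t1) * (1 + v)) =
      (1 + t1) * (1 - v) / ((1 - t1) * (1 + v)).
    by field; rewrite !gt_eqF.
  have E3 : 1 - x * (2 * (v - t1) / ((1 - t1) * (1 + v))) =
      (1 + t1) * (v - t2) / ((t1 - t2) * (1 + v)).
    by rewrite xE; field; rewrite !gt_eqF.
  have E4 : 1 - y * (2 * (v - t1) / ((1 - t1) * (1 + v))) =
      (1 + t1) * (v + t2) / ((t1 + t2) * (1 + v)).
    by rewrite yE; field; rewrite !gt_eqF.
  have E5 : (2 * (1 - t1) - - (2 * t1) * (1 - t1)) / ((1 - t1) * v + (1 - t1)) ^+ 2 =
      2 * (1 + t1) / ((1 - t1) * (1 + v) ^+ 2).
    by rewrite den; field; rewrite !gt_eqF.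
  have j0 : 0 < 2 * (1 + t1) / ((1 - t1) * (1 + v) ^+ 2).
    by rewrite divr_gt0 ?mulr_gt0 ?exprn_gt0.
  have E6 : 1 - t1 ^+ 2 = (1 - t1) * (1 + t1) by ring.
  have E7 : t1 ^+ 2 - t2 ^+ 2 = (t1 - t2) * (t1 + t2) by ring.
  have E8 : 1 - v ^+ 2 = (1 - v) * (1 + v) by ring.
  have E9 : v ^+ 2 - t2 ^+ 2 = (v - t2) * (v + t2) by ring.
  rewrite E1 E2 E3 E4 E5 E6 E7 E8 E9 -EFinM; congr (_%:E).
  rewrite -[X in _ * X = _](lnK j0).
  rewrite !powR_expR_ln ?divr_gt0 ?mulr_gt0//.
  rewrite -!expRD; congr expR.
  rewrite !(ln_div, lnM, lnXn) ?posrE ?mulr_gt0 ?invr_gt0 ?exprn_gt0//.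
  by rewrite mulr2n; ring.
- have -> : 2 * (1 - t1) - - (2 * t1) * (1 - t1) = 2 * (1 + t1) * (1 - t1) by ring.
  by rewrite !mulr_gt0.
- move=> v /andP[tv v1].
  have -> : (1 - t1) * v + (1 - t1) = (1 - t1) * (1 + v) by ring.
  by rewrite mulr_gt0//; lra.
- move=> v /andP[tv v1].
  have den0 : 0 < (1 - t1) * v + (1 - t1).
    have -> : (1 - t1) * v + (1 - t1) = (1 - t1) * (1 + v) by ring.
    by rewrite mulr_gt0//; lra.
  rewrite /= in_itv/=; apply/andP; split; first by rewrite divr_gt0//; lra.
  rewrite ltr_pdivrMr// mul1r -subr_gt0.
  have -> : (1 - t1) * v + (1 - t1) - (2 * v - 2 * t1) = (1 + t1) * (1 - v) by ring.
  by rewrite mulr_gt0//; lra.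
- move=> u; rewrite /= in_itv/= => /andP[u0 u1].
  have den0 : 0 < 2 - (1 - t1) * u by nra.
  split; first (apply/andP; split).
  + rewrite ltr_pdivlMr// -subr_gt0.
    have -> : 2 * t1 + (1 - t1) * u - t1 * (2 - (1 - t1) * u) =
        (1 - t1) * (1 + t1) * u by ring.
    by rewrite !mulr_gt0.
  + rewrite ltr_pdivrMr// mul1r -subr_gt0.
    have -> : 2 - (1 - t1) * u - (2 * t1 + (1 - t1) * u) = 2 * (1 - t1) * (1 - u) by ring.
    by rewrite !mulr_gt0// subr_gt0.
  + field; rewrite !gt_eqF//=.
    have -> : (1 - t1) * (2 * t1 + (1 - t1) * u) + (1 - t1) * (2 - (1 - t1) * u) =
        2 * (1 - t1) * (1 + t1) by ring.
    by rewrite !mulr_gt0.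
- move=> u; rewrite /= in_itv/= => /andP[u0 u1].
  have cst_mul k : 1 - k * w @[w --> u] --> 1 - k * u.
    apply: cvgB; first exact: cvg_cst.
    by apply: cvgM; [exact: cvg_cst|exact: cvg_id].
  have lin k : k < 0 -> 0 < 1 - k * u by move=> k0; nra.
  apply: cvgM; last by apply: cvg_powR; [exact: cst_mul|exact: lin].
  apply: cvgM; last by apply: cvg_powR; [exact: cst_mul|exact: lin].
  apply: cvgM; first by apply: cvg_powR => //; apply: cvg_id.
  apply: cvg_powR; last by rewrite subr_gt0.
  by apply: cvgB; [exact: cvg_cst|exact: cvg_id].
- by move=> u _; rewrite !mulr_ge0 ?powR_ge0.
Qed.

(** Under the affine map u = (w-t1^2)/(1-t1^2) the points w = t1^2, 1, 0, t2^2 go to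
    u = 0, 1, 1/x, 1/y. *)
Lemma appell_integral_second_marginal (R : realType) (a b t1 t2 : R) :
  0 < t2 -> t2 < t1 -> t1 < 1 ->
  let x := (t1 ^+ 2 - 1) / t1 ^+ 2 in
  let y := (t1 ^+ 2 - 1) / (t1 ^+ 2 - t2 ^+ 2) in
  (\int[lebesgue_measure]_(u in `]0%R, 1%R[)
     (u `^ (a + b - 1) * (1 - u) `^ (a + 2 * b - (a + b) - 1) *
      (1 - x * u) `^ (- (a + b - 1 / 2)) * (1 - y * u) `^ (- (1 - a)))%:E =
   (t1 `^ (2 * a + 2 * b - 1) * (1 - t1 ^+ 2) `^ (1 - a - 2 * b) *
    (t1 ^+ 2 - t2 ^+ 2) `^ (1 - a))%:E *
   second_marginal a b t1 t2)%E.
Proof.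
move=> t20 t21 t11 x y; rewrite /second_marginal.
have t10 : 0 < t1 by exact: lt_trans t21.
have t1s0 : 0 < t1 ^+ 2 by rewrite exprn_gt0.
have t1s1 : t1 ^+ 2 < 1 by rewrite expr_lt1// ltW.
have p1 : 0 < 1 - t1 ^+ 2 by rewrite subr_gt0.
have p2 : 0 < t1 ^+ 2 - t2 ^+ 2 by nra.
have xE : x = - ((1 - t1 ^+ 2) / t1 ^+ 2) by rewrite /x; field; rewrite gt_eqF.
have yE : y = - ((1 - t1 ^+ 2) / (t1 ^+ 2 - t2 ^+ 2)) by rewrite /y; field; rewrite gt_eqF.
have x0 : x < 0 by rewrite xE oppr_lt0 divr_gt0.
have y0 : y < 0 by rewrite yE oppr_lt0 divr_gt0.
rewrite -ge0_integralZl//; last 3 first.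
- apply/measurable_EFinP/measurable_funTS.
  apply: measurable_funM; apply: measurable_funM => //.
  + by apply: measurableT_comp (measurable_powR _) _; exact: measurable_funB.
  + by apply: measurableT_comp (measurable_powR _) _; exact: measurable_funB.
  + by apply: measurableT_comp (measurable_powR _) _; exact: measurable_funB.
- by move=> v _; rewrite lee_fin !mulr_ge0 ?powR_ge0.
- by rewrite lee_fin !mulr_ge0 ?powR_ge0.
rewrite (@ge0_integration_by_moebius _ 1 (- t1 ^+ 2) 0 (1 - t1 ^+ 2) (t1 ^+ 2) 1
  (fun u => t1 ^+ 2 + (1 - t1 ^+ 2) * u) _ _ t1s1)//.
- apply: eq_integral => w; rewrite inE/= in_itv/= => /andP[tw w1].
  have w0 : 0 < w by exact: lt_trans tw.
  have [q1 q2 q3] : [/\ 0 < w - t1 ^+ 2, 0 < 1 - w & 0 < w - t2 ^+ 2].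
    by split; lra.
  rewrite !mul1r !mul0r !add0r mulr0 subr0.
  have E2 : 1 - (w - t1 ^+ 2) / (1 - t1 ^+ 2) = (1 - w) / (1 - t1 ^+ 2).
    by field; rewrite gt_eqF.
  have E3 : 1 - x * ((w - t1 ^+ 2) / (1 - t1 ^+ 2)) = w / t1 ^+ 2.
    by rewrite xE; field; rewrite !gt_eqF.
  have E4 : 1 - y * ((w - t1 ^+ 2) / (1 - t1 ^+ 2)) =
      (w - t2 ^+ 2) / (t1 ^+ 2 - t2 ^+ 2).
    by rewrite yE; field; rewrite !gt_eqF.
  have j0 : 0 < (1 - t1 ^+ 2) / (1 - t1 ^+ 2) ^+ 2.
    by rewrite divr_gt0 ?exprn_gt0.
  rewrite E2 E3 E4 -EFinM; congr (_%:E).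
  rewrite -[X in _ * X = _](lnK j0).
  rewrite !powR_expR_ln ?divr_gt0//.
  rewrite -!expRD; congr expR.
  rewrite !ln_div ?posrE ?exprn_gt0// !lnXn//.
  by rewrite !mulr2n; field.
- by rewrite mul1r mulr0 subr0.
- by move=> w _; rewrite mul0r add0r.
- move=> w /andP[tw w1]; rewrite mul1r mul0r add0r /= in_itv/= divr_gt0 ?subr_gt0//=.
  by rewrite ltr_pdivrMr// mul1r ltrD2r.
- move=> u; rewrite /= in_itv/= => /andP[u0 u1]; split; last first.
    by field; rewrite gt_eqF.
  by apply/andP; split; nra.
- move=> u; rewrite /= in_itv/= => /andP[u0 u1].
  have cst_mul k : 1 - k * w @[w --> u] --> 1 - k * u.
    apply: cvgB; first exact: cvg_cst.
    by apply: cvgM; [exact: cvg_cst|exact: cvg_id].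
  have lin k : k < 0 -> 0 < 1 - k * u by move=> k0; nra.
  apply: cvgM; last by apply: cvg_powR; [exact: cst_mul|exact: lin].
  apply: cvgM; last by apply: cvg_powR; [exact: cst_mul|exact: lin].
  apply: cvgM; first by apply: cvg_powR => //; apply: cvg_id.
  apply: cvg_powR; last by rewrite subr_gt0.
  by apply: cvgB; [exact: cvg_cst|exact: cvg_id].
- by move=> u _; rewrite !mulr_ge0 ?powR_ge0.
Qed.

(** * Exchanging the order of integration *)

Lemma lt_sqrt_sqr (R : realType) (v w : R) : 0 <= v -> 0 < w ->
  (v < Num.sqrt w) = (v ^+ 2 < w).
Proof. by move=> v0 w0; rewrite -{1}(ger0_norm v0) -sqrtr_sqr ltr_sqrt. Qed.

Lemma beta_prime_ge0 (R : realType) (p q : R) : (0 <= beta_prime p q)%E.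
Proof.
by apply: integral_ge0 => v _; rewrite lee_fin mulr_ge0 ?powR_ge0.
Qed.

(** Tonelli's theorem for h. The two sides differ by which inner integral is
    evaluated first, and each evaluation leaves its own Beta constant. *)
Lemma double_integral_exchange (R : realType) (a b t1 t2 : R) :
  0 < t2 -> t2 < t1 -> t1 < 1 ->
  (((1 - t2 ^+ 2) `^ (- (1 - (a + b))))%:E * beta_prime (1 - (a + b)) b *
   first_marginal a b t1 t2 =
   (2 `^ (- (2 * (a + b) - 1)))%:E * beta_prime (2 * (a + b) - 1) (1 - (a + b)) *
   second_marginal a b t1 t2)%E.
Proof.
move=> t20 t21 t11; rewrite /first_marginal /second_marginal; set s := a + b.
have t10 : 0 < t1 by exact: lt_trans t21.
pose mu := @lebesgue_measure R.
have mpow (f : R -> R) (r : R) (D : set R) : measurable_fun setT f ->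
    measurable_fun (D : set (measurableTypeR R)) (fun x => f x `^ r).
  by move=> mf; apply: measurable_funTS; apply: measurableT_comp (measurable_powR _) _.
pose h (z : R * R) := (z.1 - t1) `^ (2 * s - 1 - 1) *
  ((z.2 - z.1 ^+ 2) `^ (1 - s - 1) * ((1 - z.2) `^ (b - 1) * (z.2 - t2 ^+ 2) `^ (a - 1))).
have h0 z : 0 <= h z by rewrite !mulr_ge0 ?powR_ge0.
pose P (z : R * R) := [&& t1 < z.1, z.1 ^+ 2 < z.2 & z.2 < 1].
have mP : measurable ([set z | P z] : set (measurableTypeR R * measurableTypeR R)).
  have mPf : measurable_fun (setT : set (measurableTypeR R * measurableTypeR R)) P.
    apply: measurable_and; first exact: measurable_fun_ltr.
    apply: measurable_and; last exact: measurable_fun_ltr.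
    by apply: measurable_fun_ltr => //; exact: measurable_funX.
  rewrite (_ : [set z | P z] = setT `&` P @^-1` [set true]); first exact: mPf.
  by rewrite setTI; apply/seteqP; split => z /=; case: (P z).
have mh : measurable_fun (setT : set (measurableTypeR R * measurableTypeR R)) h.
  apply: measurable_funM.
    apply: measurableT_comp (measurable_powR _) _.
    exact: measurable_funB.
  apply: measurable_funM.
    apply: measurableT_comp (measurable_powR _) _.
    by apply: measurable_funB => //; exact: measurable_funX.
  apply: measurable_funM; apply: measurableT_comp (measurable_powR _) _.
    exact: measurable_funB.
  exact: measurable_funB.
have sb : - (1 - s + b) = a - 1 by rewrite /s; ring.
(* Singular points v^2, 1, t2^2. *)
have inner_w v : t1 < v < 1 ->
  (\int[mu]_(w in `](v ^+ 2)%R, 1%R[) (h (v, w))%:E =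
   ((1 - t2 ^+ 2) `^ (- (1 - s)))%:E * beta_prime (1 - s) b *
   ((v - t1) `^ (2 * s - 1 - 1) *
    ((1 - v ^+ 2) `^ (- a) * (v ^+ 2 - t2 ^+ 2) `^ (- b)))%:E)%E.
  move=> /andP[tv v1]; have v0 : 0 < v by exact: lt_trans tv.
  have v21 : v ^+ 2 < 1 by rewrite expr_lt1// ltW.
  have v2t : 0 < v ^+ 2 - t2 ^+ 2 by nra.
  have := euler_integral_moebius (1 - s) b v21 v2t.
  rewrite sb (_ : 1 - s + b - 1 = - a); last by rewrite /s; ring.
  move=> euler; rewrite muleC muleA -EFinM.
  rewrite (_ : _ * _ * _ = (v - t1) `^ (2 * s - 1 - 1) *
    ((1 - v ^+ 2) `^ (- a) * (v ^+ 2 - t2 ^+ 2) `^ (- b) *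
     (1 - t2 ^+ 2) `^ (- (1 - s)))); last by ring.
  rewrite EFinM -muleA -euler -ge0_integralZl//.
  - by apply: eq_integral => w _; rewrite -EFinM /h/=; congr (_%:E); ring.
  - apply/measurable_EFinP.
    apply: measurable_funM; last by apply: mpow; exact: measurable_funB.
    by apply: measurable_funM; apply: mpow; exact: measurable_funB.
  - by move=> w _; rewrite lee_fin !mulr_ge0 ?powR_ge0.
  - by rewrite lee_fin powR_ge0.
(* Singular points t1, sqrt w, - sqrt w. *)
have inner_v w : t1 ^+ 2 < w < 1 ->
  (\int[mu]_(v in `]t1, (Num.sqrt w)%R[) (h (v, w))%:E =
   (2 `^ (- (2 * s - 1)))%:E * beta_prime (2 * s - 1) (1 - s) *
   ((1 - w) `^ (b - 1) * (w - t2 ^+ 2) `^ (a - 1) *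
    ((w - t1 ^+ 2) `^ (s - 1) * w `^ (1 / 2 - s)))%:E)%E.
  move=> /andP[tw w1]; have w0 : 0 < w by apply: le_lt_trans tw; exact: sqr_ge0.
  have tr : t1 < Num.sqrt w by rewrite lt_sqrt_sqr// ltW.
  have r0 : 0 < Num.sqrt w by rewrite sqrtr_gt0.
  have r2 : Num.sqrt w ^+ 2 = w by rewrite sqr_sqrtr// ltW.
  have tr0 : 0 < t1 + Num.sqrt w by rewrite addr_gt0.
  have rt0 : 0 < Num.sqrt w - t1 by rewrite subr_gt0.
  have := euler_integral_moebius (2 * s - 1) (1 - s) tr tr0.
  rewrite (_ : 2 * s - 1 + (1 - s) = s); last by ring.
  have -> : (Num.sqrt w - t1) `^ (s - 1) * (t1 + Num.sqrt w) `^ (- (1 - s)) *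
      (Num.sqrt w + Num.sqrt w) `^ (- (2 * s - 1)) =
      2 `^ (- (2 * s - 1)) * ((w - t1 ^+ 2) `^ (s - 1) * w `^ (1 / 2 - s)).
    have -> : w - t1 ^+ 2 = (Num.sqrt w - t1) * (t1 + Num.sqrt w).
      by rewrite -{1}r2; ring.
    have -> : Num.sqrt w + Num.sqrt w = 2 * Num.sqrt w by ring.
    rewrite -[in X in _ = _ * (_ * X)]r2 !powR_expR_ln ?mulr_gt0 ?exprn_gt0// -!expRD; congr expR.
    rewrite !(lnM, lnXn) ?posrE//.
    by rewrite mulr2n; field.
  move=> euler.
  rewrite muleC muleA -EFinM -[X in (X%:E * _)%E]mulrA [X in _ * X]mulrC.
  rewrite EFinM -muleA -euler -ge0_integralZl//.
  - apply: eq_integral => v; rewrite inE/= in_itv/= => /andP[tv vw].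
    have v0 : 0 < v by exact: lt_trans tv.
    have vr0 : 0 < Num.sqrt w - v by rewrite subr_gt0.
    have rv0 : 0 < v + Num.sqrt w by rewrite addr_gt0.
    rewrite -EFinM /h/=; congr (_%:E).
    have -> : w - v ^+ 2 = (Num.sqrt w - v) * (v + Num.sqrt w).
      by rewrite -{1}r2; ring.
    rewrite powRM ?ltW// (_ : 1 - s - 1 = - s); last by ring.
    by ring.
  - apply/measurable_EFinP.
    apply: measurable_funM; last by apply: mpow; exact: measurable_funD.
    by apply: measurable_funM; apply: mpow; exact: measurable_funB.
  - by move=> v _; rewrite lee_fin !mulr_ge0 ?powR_ge0.
  - by rewrite lee_fin !mulr_ge0 ?powR_ge0.
pose K1 := (((1 - t2 ^+ 2) `^ (- (1 - s)))%:E * beta_prime (1 - s) b)%E.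
pose K2 := ((2 `^ (- (2 * s - 1)))%:E * beta_prime (2 * s - 1) (1 - s))%E.
have K10 : (0 <= K1)%E by rewrite mule_ge0 ?beta_prime_ge0 ?lee_fin ?powR_ge0.
have K20 : (0 <= K2)%E by rewrite mule_ge0 ?beta_prime_ge0 ?lee_fin ?powR_ge0.
rewrite -/K1 -/K2.
rewrite -(@ge0_integralZl _ _ _ _ _ _ _ _ K1); last 4 first.
- by [].
- apply/measurable_EFinP; apply: measurable_funM.
    by apply: mpow; exact: measurable_funB.
  apply: measurable_funM; apply: mpow; apply: measurable_funB => //;
    exact: measurable_funX.
- by move=> v _; rewrite lee_fin !mulr_ge0 ?powR_ge0.
- by [].
rewrite -(@ge0_integralZl _ _ _ _ _ _ _ _ K2); last 4 first.
- by [].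
- apply/measurable_EFinP; apply: measurable_funM.
    by apply: measurable_funM; apply: mpow; exact: measurable_funB.
  by apply: measurable_funM; apply: mpow => //; exact: measurable_funB.
- by move=> v _; rewrite lee_fin !mulr_ge0 ?powR_ge0.
- by [].
transitivity (\int[mu]_(v in `]t1, 1%R[) \int[mu]_(w in `](v ^+ 2)%R, 1%R[)
    (h (v, w))%:E)%E.
  apply: eq_integral => v; rewrite inE/= in_itv/= => v1.
  by rewrite inner_w.
transitivity (\int[mu]_(w in `](t1 ^+ 2)%R, 1%R[)
    \int[mu]_(v in `]t1, (Num.sqrt w)%R[) (h (v, w))%:E)%E; last first.
  apply: eq_integral => w; rewrite inE/= in_itv/= => w1.
  by rewrite inner_v.
apply: (@tonelli_region _ h _ _ (fun v => `](v ^+ 2)%R, 1%R[%classic)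
  (fun w => `]t1, Num.sqrt w[%classic) [set z | P z]) => //.
- move=> v w; rewrite /= !in_itv/= /P/=; split.
    move=> /and3P[tv vw w1]; rewrite tv vw w1; split=> //.
    have v0 : 0 < v by exact: lt_trans tv.
    by rewrite -(@expr_lt1 _ 2)// ?ltW// (lt_trans vw).
  by move=> [/andP[tv _] /andP[vw w1]]; rewrite tv vw.
- move=> v w; rewrite /= !in_itv/= /P/=; split.
    move=> /and3P[tv vw w1]; have v0 : 0 < v by exact: lt_trans tv.
    have w0 : 0 < w by rewrite (lt_trans _ vw)// exprn_gt0.
    rewrite w1 tv lt_sqrt_sqr ?ltW// vw; split=> //.
    by rewrite andbT (lt_trans _ vw)// ltr_pXn2r// nnegrE ltW.
  move=> [/andP[tw w1] /andP[tv vw]].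
  have w0 : 0 < w by rewrite (lt_trans _ tw)// exprn_gt0.
  by rewrite tv w1 -lt_sqrt_sqr ?vw// ltW// (lt_trans t10).
Qed.

(** * The quadratic transformation *)

(** Holds at infinity too because [fine] sends both infinities to 0, so that an
    identity between multiples of extended-real integrals descends to the
    real-valued ones. *)
Lemma fine_EFinM (R : realType) (k : R) (x : \bar R) : 0 < k ->
  fine (k%:E * x)%E = k * fine x.
Proof.
move=> k0; case: x => [r||] /=; first by [].
  by rewrite gt0_muley ?lte_fin//= mulr0.
by rewrite gt0_muleNy ?lte_fin//= mulr0.
Qed.

Unset Implicit Arguments.
Set Strict Implicit.
Set Printing Implicit Defensive.

Theorem theorem6p3 (R : realType) (a b t1 t2 : R)
    (hb : 0 < b) (hab_lb : 1 / 2 < a + b) (hab_ub : a + b < 1)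
    (ht1_gt0 : 0 < t1) (ht1_lt1 : t1 < 1) (ht2_gt0 : 0 < t2) (ht2_lt : t2 < t1) :
  t1 `^ (2 * a + 2 * b - 1) * (1 - t2 ^+ 2) `^ (a + b - 1) *
    appellF1 (2 * a + 2 * b - 1) b b (a + 2 * b)
      ((1 - t1) * (t2 + 1) / (2 * (t2 - t1)))
      ((1 - t1) * (t2 - 1) / (2 * (t2 + t1)))
  = (t1 ^+ 2 - t2 ^+ 2) `^ (a + b - 1) *
    appellF1 (a + b) (a + b - 1 / 2) (1 - a) (a + 2 * b)
      ((t1 ^+ 2 - 1) / t1 ^+ 2)
      ((t1 ^+ 2 - 1) / (t1 ^+ 2 - t2 ^+ 2)).
Proof.
have [s0 sC0 s2 a1] : [/\ 0 < a + b, 0 < 1 - (a + b), 0 < 2 * (a + b) - 1 &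
  0 < 1 - a] by split; lra.
have p1 : 0 < 1 - t1 ^+ 2 by nra.
have p2 : 0 < 1 - t2 ^+ 2 by nra.
have p3 : 0 < t1 ^+ 2 - t2 ^+ 2 by nra.
rewrite /appellF1 /Rintegral.
have EL := appell_integral_first_marginal a b ht2_gt0 ht2_lt ht1_lt1.
have ER := appell_integral_second_marginal a b ht2_gt0 ht2_lt ht1_lt1.
cbv zeta in EL, ER; rewrite EL ER {EL ER}.
have := double_integral_exchange a b ht2_gt0 ht2_lt ht1_lt1.
rewrite (beta_primeE sC0 hb) (beta_primeE s2 sC0).
move: (first_marginal _ _ _ _) (second_marginal _ _ _ _) => JL JR.
have -> : 1 - (a + b) + b = 1 - a by ring.
have -> : 2 * (a + b) - 1 + (1 - (a + b)) = a + b by ring.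
have -> : a + 2 * b - (2 * a + 2 * b - 1) = 1 - a by ring.
have -> : a + 2 * b - (a + b) = b by ring.
have -> : 2 * a + 2 * b - 1 = 2 * (a + b) - 1 by ring.
have := Gamma_gt0 a1; have := Gamma_gt0 s2; have := Gamma_gt0 s0.
have := Gamma_gt0 sC0; have := Gamma_gt0 hb.
have -> : - (1 - (a + b)) = a + b - 1 by ring.
have -> : (t1 ^+ 2 - t2 ^+ 2) `^ b =
    (t1 ^+ 2 - t2 ^+ 2) `^ (a + b - 1) * (t1 ^+ 2 - t2 ^+ 2) `^ (1 - a).
  rewrite -powRD; first by congr (_ `^ _); ring.
  by apply/implyP => _; rewrite gt_eqF.
rewrite powRN.
(* Only the positivity of the Gamma values and of the powers matters now. *)
have : 0 < 2 `^ (2 * (a + b) - 1) :> R by rewrite powR_gt0.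
move: (Gamma (1 - (a + b))) (Gamma b) (Gamma (1 - a)) (Gamma (2 * (a + b) - 1))
  (Gamma (a + b)) (Gamma (a + 2 * b)) (2 `^ (2 * (a + b) - 1)).
move=> g1 g2 g3 g4 g5 gc T T0 G2 G1 G5 G4 G3.
have : 0 < (t1 ^+ 2 - t2 ^+ 2) `^ (a + b - 1) by rewrite powR_gt0.
have : 0 < (t1 ^+ 2 - t2 ^+ 2) `^ (1 - a) by rewrite powR_gt0.
have : 0 < (1 - t1 ^+ 2) `^ (1 - a - 2 * b) by rewrite powR_gt0.
have : 0 < (1 - t2 ^+ 2) `^ (a + b - 1) by rewrite powR_gt0.
have : 0 < t1 `^ (2 * (a + b) - 1) by rewrite powR_gt0.
move: (t1 `^ _) ((1 - t2 ^+ 2) `^ _) ((1 - t1 ^+ 2) `^ _)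
  ((t1 ^+ 2 - t2 ^+ 2) `^ (1 - a)) ((t1 ^+ 2 - t2 ^+ 2) `^ (a + b - 1)).
move=> U Y X Z1 Z2 U0 Y0 X0 Z10 Z20.
rewrite -!EFinM => /(congr1 fine).
rewrite !fine_EFinM ?mulr_gt0 ?invr_gt0 ?mulr_gt0//; move: (fine JL) (fine JR) => jL jR E0.
have {E0}E : Y * jL = T^-1 * g4 * g3 / (g5 * g2) * jR.
  apply: (mulfI (_ : g1 * g2 / g3 != 0)).
    by rewrite !mulf_neq0 ?invr_neq0 ?gt_eqF.
  transitivity (Y * (g1 * g2 / g3) * jL); first by ring.
  by rewrite E0; field; rewrite !gt_eqF.
rewrite [LHS](_ : _ = gc / (g4 * g3) * U * X * (Z2 * Z1) * T * (Y * jL));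
  last by ring.
by rewrite E; field; rewrite !gt_eqF.
Qed.
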